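(* Let $k\in\mathbb{N}$, let $0<\lambda<1$ and let $F:[0,1)\to\mathbb{R}$ be a $k$-interval piecewise $\lambda$-affine function. Then the map $f:[0,1)\to[0,1)$ defined by $f(x)=F(x)\pmod 1$ has at most $k$ periodic orbits.
   Context: $\mathbb{N}=\{1,2,\ldots\}$. A function $F:[0,1)\to\mathbb{R}$ is a $k$-interval piecewise $\lambda$-affine function if there exist real numbers $0=a_0<a_1<\cdots<a_{k-1}<a_k=1$ and $(b_1,\ldots,b_k)\in\mathbb{R}^k$ such that $F(x)=\lambda x+b_i$ for every $1\le i\le k$ and every $x\in[a_{i-1},a_i)$. Here $y\pmod 1$ denotes the representative in $[0,1)$ of $y$ modulo $\mathbb{Z}$. A periodic orbit is the forward orbit of a periodic point. *)

(* Defs.v *)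
(* MathComp-Analysis; the real line is an arbitrary [R : realType]. *)
From mathcomp Require Export all_boot all_order all_algebra.
From mathcomp Require Export boolp classical_sets functions cardinality.
From mathcomp Require Export set_interval reals.

Set Implicit Arguments.
Unset Strict Implicit.
Unset Printing Implicit Defensive.

Import Order.TTheory GRing.Theory Num.Theory.

Local Open Scope classical_set_scope.
Local Open Scope ring_scope.

(* A set coerces to the subtype of its elements, so [Ico01 R] also serves as
   the type of the points of [0, 1). *)
Definition Ico01 (R : realType) : set R := [set x | 0 <= x < 1].
Arguments Ico01 : clear implicits.

Definition mod1 (R : realType) (y : R) : R := y - (Num.floor y)%:~R.

Lemma mod1_Ico01 (R : realType) (y : R) : mod1 y \in Ico01 R.
Proof.
apply: mem_set; rewrite /Ico01 /= /mod1 subr_ge0 ltrBlDl.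
by rewrite floor_le -[X in _ + X]/(1%:~R) -intrD floorD1_gt.
Qed.

Definition mod1_map (R : realType) (F : Ico01 R -> R) (x : Ico01 R) : Ico01 R :=
  SigSub (mod1_Ico01 (F x)).

(* Only a 0, ..., a k are constrained. The index is shifted by one:
   [b i] is the constant on [a i, a (i + 1)), for 0 <= i < k. *)
Definition piecewise_affine (R : realType) (k : nat) (lambda : R)
    (F : Ico01 R -> R) : Prop :=
  exists (a : nat -> R) (b : 'I_k -> R),
    [/\ a 0%N = 0, a k = 1,
        forall i : 'I_k, a i < a i.+1 &
        forall (i : 'I_k) (x : Ico01 R), a i <= val x < a i.+1 ->
          F x = lambda * val x + b i].

Definition periodic_point (T : Type) (f : T -> T) (x : T) : Prop :=
  exists2 p : nat, (0 < p)%N & iter p f x = x.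

Definition forward_orbit (T : Type) (f : T -> T) (x : T) : set T :=
  range (fun n : nat => iter n f x).

(* Orbits are counted as sets of points: two points of the same periodic
   orbit contribute one element. *)
Definition periodic_orbits (T : Type) (f : T -> T) : set (set T) :=
  [set forward_orbit f x | x in periodic_point f].

(* Main.v *)
(** Attach to a periodic orbit a point [y] whose distance to the right endpoint
    of its piece is minimal along the orbit. If [0 <= d] is smaller than that
    distance, then [d] never makes the orbit change piece or wrap around modulo
    1, so the n-th iterate of [y + d] is the n-th iterate of [y] plus
    [lambda ^+ n * d]. If [y + d] is periodic as well, taking for [n] a common
    period gives [d = 0]. Hence each piece contains at most one such point. *)
Require Import Defs.
From mathcomp Require Import all_boot all_order all_algebra.
From mathcomp Require Import lra.
Import Order.TTheory GRing.Theory Num.Theory.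
Local Open Scope ring_scope.
Local Open Scope card_scope.

Section PeriodicPoints.
Context {T : Type} (f : T -> T).

Lemma iter_mul_period {p : nat} {x : T} :
  iter p f x = x -> forall n, iter (n * p) f x = x.
Proof. by move=> px; elim=> // n IHn; rewrite mulSn iterD IHn. Qed.

Lemma iter_mod_period {p : nat} {x : T} :
  iter p f x = x -> forall n, iter (n %% p) f x = iter n f x.
Proof.
by move=> px n; rewrite [in RHS](divn_eq n p) addnC iterD (iter_mul_period px).
Qed.

Lemma iter_periodic_point (x : T) (m : nat) :
  periodic_point f x -> periodic_point f (iter m f x).
Proof. by case=> p p0 px; exists p => //; rewrite -iterD addnC iterD px. Qed.

Lemma forward_orbit_iter (x : T) (m : nat) :
  periodic_point f x -> forward_orbit f (iter m f x) = forward_orbit f x.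
Proof.
case=> p p0 px; apply/seteqP; split=> z [n _ <-].
  by exists (n + m)%N; rewrite ?iterD.
(* After [m] steps, [m * p - m] more complete [m] full periods and lead back to [x]. *)
exists (n + (m * p - m))%N => //.
by rewrite -iterD -addnA subnK ?leq_pmulr // iterD (iter_mul_period px).
Qed.

(** Reducing exponents modulo the period leaves finitely many values to compare. *)
Lemma periodic_point_argmin (R : realType) (g : T -> R) (x : T) :
  periodic_point f x ->
  exists m, forall n, g (iter m f x) <= g (iter n f x).
Proof.
case=> -[//|p] _ px.
case: (Order.TotalTheory.arg_minP
  (fun i : 'I_p.+1 => g (iter i f x)) (isT : xpredT ord0)) => m _ min_m.
exists m => n; rewrite -(iter_mod_period px n).
exact: (min_m (Ordinal (ltn_pmod n (ltn0Sn p)))).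
Qed.

End PeriodicPoints.

Lemma mod1D (R : realType) (y t : R) :
  0 <= mod1 y + t < 1 -> mod1 (y + t) = mod1 y + t.
Proof.
rewrite /mod1 => /andP[ge0 lt1].
suff -> : Num.floor (y + t) = Num.floor y by rewrite addrAC.
apply: floor_def; rewrite intrD; apply/andP; split; lra.
Qed.

Lemma mod1_mapE (R : realType) (F : Ico01 R -> R) (x : Ico01 R) :
  val (mod1_map F x) = mod1 (F x).
Proof. by []. Qed.

(** The induction finds the largest index [i < k] with [a i <= x]. *)
Lemma exists_piece (R : realType) (k : nat) (a : nat -> R) (x : R) :
  a 0%N <= x < a k -> exists i : 'I_k, a i <= x < a i.+1.
Proof.
elim: k => [|k IHk] /andP[a0x xak]; first by have := le_lt_trans a0x xak; rewrite ltxx.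
have [akx|xak'] := leP (a k) x; first by exists ord_max; rewrite akx.
have [i xi] := IHk (introT andP (conj a0x xak')).
by exists (widen_ord (leqnSn k) i).
Qed.

Section PiecewiseAffine.
Context {R : realType} {k : nat} {lambda : R} {F : Ico01 R -> R}.
Context {a : nat -> R} {b : 'I_k -> R}.
Hypothesis hlambda : 0 < lambda < 1.
Hypothesis ak : a k = 1.
Hypothesis a_incr : forall i : 'I_k, a i < a i.+1.
Hypothesis F_affine : forall (i : 'I_k) (x : Ico01 R),
  a i <= val x < a i.+1 -> F x = lambda * val x + b i.
Context {piece : Ico01 R -> 'I_k}.
Hypothesis pieceP : forall x, a (piece x) <= val x < a (piece x).+1.

Let f := mod1_map F.
Let gap (x : Ico01 R) : R := a (piece x).+1 - val x.

(** Consequently a shift smaller than [gap x] keeps [x] below 1 as well as inside its piece. *)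
Lemma endpoint_le1 (i : 'I_k) : a i.+1 <= 1.
Proof.
rewrite -ak; apply: (@homo_leq_in _ [pred j | (j <= k)%N] a (fun x y => x <= y));
  rewrite ?inE //.
- by move=> y x z; apply: le_trans.
- by move=> j l _ lk m /andP[_ /ltnW ml]; apply: leq_trans ml lk.
- by move=> j _ jk; apply/ltW/(a_incr (Ordinal jk)).
Qed.

Lemma iter_shift (x y : Ico01 R) :
  val x <= val y -> (forall n, val y - val x < gap (iter n f x)) ->
  forall n, val (iter n f y) = val (iter n f x) + lambda ^+ n * (val y - val x).
Proof.
move=> xy small; have /andP[l0 l1] := hlambda.
have d0 : 0 <= val y - val x by rewrite subr_ge0.
(* The contraction only shrinks the initial distance, so the bound assumed for that distance
   persists. *)
have small_iter n : 0 <= lambda ^+ n * (val y - val x) < gap (iter n f x).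
  rewrite mulr_ge0 ?exprn_ge0 ?(ltW l0) //=; apply: le_lt_trans (small n).
  by rewrite ler_piMl // exprn_ile1 // ltW.
elim=> [|n IHn]; first by rewrite expr0 mul1r addrC subrK.
have /andP[u0 u1] := pieceP (iter n f x).
have /andP[t0 t1] := small_iter n.
have piece_y : a (piece (iter n f x)) <= val (iter n f y) < a (piece (iter n f x)).+1.
  by rewrite IHn; move: t1; rewrite /gap => t1; apply/andP; split; lra.
rewrite !iterS /f !mod1_mapE (F_affine _ _ piece_y) IHn mulrDr addrAC mulrA -exprS.
(* Both iterates use the same constant [b i], so it folds back into [F] at the iterate of [x]. What
   remains is that adding the shift after reduction modulo 1 does not leave [0, 1). *)
rewrite -(F_affine _ _ (pieceP _)) mod1D // -mod1_mapE -/f -iterS.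
have /andP[s0 s1] := small_iter n.+1.
have le1 := endpoint_le1 (piece (iter n.+1 f x)).
have /andP[v0 _] : 0 <= val (iter n.+1 f x) < 1 by exact: (set_mem (valP (iter n.+1 f x))).
by apply/andP; split; rewrite /gap in s1; lra.
Qed.

Definition gap_minimal (x : Ico01 R) : Prop :=
  periodic_point f x /\ forall n, gap x <= gap (iter n f x).

Lemma gap_minimal_le_inj (x y : Ico01 R) :
  gap_minimal x -> periodic_point f y -> piece x = piece y ->
  val x <= val y -> x = y.
Proof.
move=> [[p p0 px] min_x] [q q0 qy] xy_piece le_xy.
have /andP[_ y1] := pieceP y.
(* Both points lie left of the same right endpoint. *)
have close : val y - val x < gap x by rewrite /gap xy_piece ltrD2r.
have := iter_shift x y le_xy (fun n => lt_le_trans close (min_x n)) (q * p)%N.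
rewrite {1}mulnC !iter_mul_period // => /eqP.
(* With [d = val y - val x], the equation becomes [(1 - lambda ^+ (q * p)) * d = 0]; the first
   factor is nonzero because [q * p] is positive. *)
rewrite addrC -subr_eq -[X in X == _]mul1r -subr_eq0 -mulrBl mulf_eq0 !subr_eq0.
case/orP=> [/eqP one|/eqP/val_inj->//].
have /andP[l0 l1] := hlambda.
have := exprn_ilt1 (q * p) (ltW l0) l1.
by rewrite -one ltxx muln_eq0 !eqn0Ngt q0 p0.
Qed.

Lemma gap_minimal_inj (x y : Ico01 R) :
  gap_minimal x -> gap_minimal y -> piece x = piece y -> x = y.
Proof.
move=> hx hy xy_piece; have [le_xy|/ltW le_yx] := leP (val x) (val y).
  exact: gap_minimal_le_inj hx hy.1 xy_piece le_xy.
exact/esym/(gap_minimal_le_inj _ _ hy hx.1 (esym xy_piece) le_yx).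
Qed.

Lemma gap_minimal_exists (x : Ico01 R) :
  periodic_point f x ->
  exists2 y, gap_minimal y & forward_orbit f y = forward_orbit f x.
Proof.
move=> per_x; have [m min_m] := periodic_point_argmin f R gap x per_x.
exists (iter m f x); last exact: forward_orbit_iter.
by split=> [|n]; [exact: iter_periodic_point | rewrite -iterD].
Qed.

Lemma periodic_orbits_card_le : periodic_orbits f #<= `I_k.
Proof.
(* Sends a piece index to the orbit of its gap-minimal point, with the empty set as default for
   pieces that have none. Every periodic orbit is then in the image of [I_k]. *)
pose orbit_of (n : nat) : set (Ico01 R) :=
  xget classical_sets.set0 [set O | exists y,
    [/\ gap_minimal y, nat_of_ord (piece y) = n & O = forward_orbit f y]]%classic.
apply: card_le_trans (card_image_le orbit_of `I_k).
apply: subset_card_le => _ [x per_x <-].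
have [y min_y <-] := gap_minimal_exists x per_x.
exists (piece y) => //=.
(* The selected orbit may come from another point [z] of the piece, but injectivity forces [z = y];
   the default case is excluded by [y] itself. *)
rewrite /orbit_of; case: xgetP => [O _ [z [min_z zy ->]]|/(_ (forward_orbit f y))].
  by rewrite (gap_minimal_inj _ _ min_z min_y (val_inj zy)).
by case; exists y.
Qed.

End PiecewiseAffine.

Theorem corollary3 (R : realType) (k : nat) (lambda : R) (F : Ico01 R -> R)
    (hk : (1 <= k)%N) (hlambda : 0 < lambda < 1)
    (hF : piecewise_affine k lambda F) :
  periodic_orbits (mod1_map F) #<= `I_k.
Proof.
case: hF => a [b [a0 ak a_incr F_affine]].
have /choice[piece pieceP] : forall x : Ico01 R, exists i : 'I_k,
    a i <= val x < a i.+1.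
  by move=> x; apply: exists_piece; rewrite a0 ak; exact: set_mem (valP x).
exact: (periodic_orbits_card_le hlambda ak a_incr F_affine pieceP).
Qed.
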